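(* Let $\rho_0$ be an $n$-qubit state, $O$ a Hermitian $n$-qubit operator, $G$ an $n$-qubit Pauli operator, $u>0$, $R_G(\theta)=\exp(-iu\theta G)$, and $C(\theta)=\mathrm{Tr}\big[UR_G(\theta)V\rho_0V^\dagger R_G(\theta)^\dagger U^\dagger O\big]$, where $U\sim\mathcal{E}_U$ is drawn from an arbitrary ensemble and $V\sim\mathcal{E}_V$ is drawn independently from a locally scrambling ensemble. Let $\Gamma\subseteq[n]$ be a set of qubits with $\mathrm{supp}(G)\subseteq\Gamma$ and $\mathrm{supp}(U^\dagger OU)\subseteq\Gamma$ for every $U$ in the support of $\mathcal{E}_U$. Let $\rho_\Gamma(V)$ be the reduced state on $\Gamma$ of $V\rho_0V^\dagger$, and define the effective reduced state $$\varrho_\Gamma(V):=2^{-|\Gamma|}\Big(\mathds{1}_\Gamma+\sum_{g\in\mathcal{P}_\Gamma,\;gG+Gg=0} \mathrm{Tr}[g\,\rho_\Gamma(V)]\,g\Big).$$ Then for every fixed $\theta$, $$\mathrm{Var}(\partial_\theta C)\le u^2\,\|O\|_\infty^2\,2^{|\Gamma|+2}\,\mathbf{E}_V\,D_{\rm HS}^2[\varrho_\Gamma(V)],$$ where $D_{\rm HS}(\sigma)=\|\sigma-\mathds{1}_\Gamma/2^{|\Gamma|}\|_F$.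
   Context: Locally scrambling ensemble: an ensemble $\mathcal{E}$ of $n$-qubit unitaries such that for every tensor product $\bigotimes_j V_j$ of single-qubit Clifford gates, $(\bigotimes_j V_j)V$ has the same distribution as $V\sim\mathcal{E}$. $\mathcal{P}_\Gamma$ is the set of non-identity Pauli strings supported on $\Gamma$ (equivalently, $n$-qubit Pauli strings acting as the identity outside $\Gamma$); the commutation $gG+Gg=0$ is taken with $G$ viewed as an operator on $\Gamma$. $\mathrm{supp}(X)$ is the set of qubits on which $X$ acts non-trivially, $\|\cdot\|_\infty$ the operator norm, $\|\cdot\|_F$ the Frobenius norm. The variance is over $U$ and $V$. *)

(* Defs.v *)
From HB Require Import structures.
From mathcomp Require Import all_boot all_order all_algebra.
From mathcomp Require Import all_classical all_reals all_analysis.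
From mathcomp Require Import complex.
Set Implicit Arguments. Unset Strict Implicit. Unset Printing Implicit Defensive.
Import Order.TTheory GRing.Theory Num.Theory.
Local Open Scope ring_scope.
Local Open Scope classical_set_scope.
Local Open Scope complex_scope.

Section Qubits.
Variable R : realType.
Local Notation C := R[i].

Definition q_cabs (z : C) : R := Num.sqrt (complex.Re z ^+ 2 + complex.Im z ^+ 2).

(* ---------- Operators on a register of qubits labelled by a finite type Q.
   Computational q_basis states are bit strings Q -> bool; an operator is
   given by its matrix entries <x|A|y>. *)
Section Ops.
Variable Q : finType.
Definition q_basis := {ffun Q -> bool}.
Definition q_op := q_basis -> q_basis -> C.

Definition q_opI : q_op := fun x y => (x == y)%:R.
Definition q_opmul (A B : q_op) : q_op := fun x y => \sum_z A x z * B z y.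
Definition q_opadd (A B : q_op) : q_op := fun x y => A x y + B x y.
Definition q_opsub (A B : q_op) : q_op := fun x y => A x y - B x y.
Definition q_opscale (c : C) (A : q_op) : q_op := fun x y => c * A x y.
Definition q_opadj (A : q_op) : q_op := fun x y => conjc (A y x).
Definition q_optr (A : q_op) : C := \sum_x A x x.
Definition q_oppow (A : q_op) (k : nat) : q_op := iter k (q_opmul A) q_opI.

Definition q_hermitian (A : q_op) : Prop := forall x y, q_opadj A x y = A x y.
Definition q_unitary (U : q_op) : Prop := forall x y, q_opmul (q_opadj U) U x y = q_opI x y.
Definition q_psd (A : q_op) : Prop :=
  forall v : q_basis -> C, 0 <= \sum_x \sum_y conjc (v x) * A x y * v y.
Definition q_density (rho : q_op) : Prop := q_psd rho /\ q_optr rho = 1.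

Definition q_vnorm (v : q_basis -> C) : R := Num.sqrt (\sum_x q_cabs (v x) ^+ 2).
Definition q_opapply (A : q_op) (v : q_basis -> C) : q_basis -> C :=
  fun x => \sum_y A x y * v y.
Definition q_opnorm (A : q_op) : R :=
  sup [set q_vnorm (q_opapply A v) | v in [set v | q_vnorm v = 1]].
Definition q_frob (A : q_op) : R := Num.sqrt (\sum_x \sum_y q_cabs (A x y) ^+ 2).

Definition q_expm (A : q_op) : q_op := fun x y =>
  (limn (fun N => \sum_(k < N) complex.Re ((k`!)%:R^-1 * q_oppow A k x y)))
  +i* (limn (fun N => \sum_(k < N) complex.Im ((k`!)%:R^-1 * q_oppow A k x y))).

(* single-qubit Pauli matrices: 0 = I, 1 = X, 2 = Y, 3 = Z; bit false = |0> *)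
Definition q_sigma (a : 'I_4) (b c : bool) : C :=
  match val a with
  | 0 => (b == c)%:R
  | 1 => (b != c)%:R
  | 2 => if b == c then 0 else if b then 'i else - 'i
  | _ => if b == c then (if b then -1 else 1) else 0
  end.

Definition q_pstring := {ffun Q -> 'I_4}.
Definition q_pid : q_pstring := [ffun => ord0].
Definition q_pauli (p : q_pstring) : q_op := fun x y => \prod_k q_sigma (p k) (x k) (y k).

Definition q_anticommuteb (A B : q_op) : bool :=
  [forall x, forall y, q_opmul A B x y + q_opmul B A x y == 0].

Definition q_op1 := bool -> bool -> C.
Definition q_id1 : q_op1 := fun b c => (b == c)%:R.
Definition q_mul1 (A B : q_op1) : q_op1 := fun b c => \sum_d A b d * B d c.
Definition q_had : q_op1 := fun b c => ((if b && c then -1 else 1) / Num.sqrt 2)%:C.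
Definition q_sgate : q_op1 := fun b c => if b == c then (if b then 'i else 1) else 0.
Definition q_cliff_word (w : seq bool) : q_op1 :=
  foldr (fun h M => q_mul1 (if h then q_had else q_sgate) M) q_id1 w.
Definition q_clifford1 (c : q_op1) : Prop :=
  exists w, forall b d, c b d = q_cliff_word w b d.
Definition q_tens (c : Q -> q_op1) : q_op := fun x y => \prod_k c k (x k) (y k).

End Ops.

Section NQubits.
Variable n : nat.
Local Notation opn := (q_op 'I_n).

Definition q_clrbit (k : 'I_n) (x : q_basis 'I_n) : q_basis 'I_n :=
  [ffun j => if j == k then false else x j].
(* X acts trivially on qubit k:  X = 1_k (x) Y *)
Definition q_acts_trivially (X : opn) (k : 'I_n) : Prop :=
  forall x y, X x y = if x k == y k then X (q_clrbit k x) (q_clrbit k y) else 0.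
Definition q_supp_sub (X : opn) (Gamma : {set 'I_n}) : Prop :=
  forall k, k \notin Gamma -> q_acts_trivially X k.

Definition q_qsub (Gamma : {set 'I_n}) := {k : 'I_n | k \in Gamma}.
Definition q_restr (Gamma : {set 'I_n}) (a : q_basis 'I_n) : q_basis (q_qsub Gamma) :=
  [ffun s => a (val s)].
Definition q_prestr (Gamma : {set 'I_n}) (p : q_pstring 'I_n) : q_pstring (q_qsub Gamma) :=
  [ffun s => p (val s)].
Definition q_ptrace (Gamma : {set 'I_n}) (rho : opn) : q_op (q_qsub Gamma) :=
  fun x y => \sum_a \sum_b
    (if [&& q_restr Gamma a == x, q_restr Gamma b == y &
            [forall k, (k \notin Gamma) ==> (a k == b k)]]
     then rho a b else 0).

Definition q_eff_state (Gamma : {set 'I_n}) (GG : q_op (q_qsub Gamma))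
    (rhoG : q_op (q_qsub Gamma)) : q_op (q_qsub Gamma) :=
  q_opscale ((2 ^ #|Gamma|)%:R^-1)
    (q_opadd (q_opI (Q:=q_qsub Gamma))
       (fun x y => \sum_(h : q_pstring (q_qsub Gamma) |
                          (h != q_pid (q_qsub Gamma)) && q_anticommuteb (q_pauli h) GG)
                    q_optr (q_opmul (q_pauli h) rhoG) * q_pauli h x y)).

Definition q_DHS (Gamma : {set 'I_n}) (s : q_op (q_qsub Gamma)) : R :=
  q_frob (q_opsub s (q_opscale ((2 ^ #|Gamma|)%:R^-1) (q_opI (Q:=q_qsub Gamma)))).

Definition q_RG (G : opn) (u theta : R) : opn :=
  q_expm (q_opscale (- 'i * (u * theta)%:C) G).
(* C(theta) = Tr[U R_G V rho0 V^dag R_G^dag U^dag O] (real since O Hermitian;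
   we take the real part) *)
Definition q_cost (rho0 O G : opn) (u : R) (U V : opn) (theta : R) : R :=
  complex.Re (q_optr (q_opmul (q_opmul (q_opmul (q_opmul (q_opmul (q_opmul (q_opmul U (q_RG G u theta)) V)
      rho0) (q_opadj V)) (q_opadj (q_RG G u theta))) (q_opadj U)) O)).

(* q_sigma-algebra on n-qubit operators generated by the real and imaginary
   parts of the matrix entries (Borel q_sigma-algebra of C^(2^n x 2^n)) *)
Definition q_opsigma : set (set opn) :=
  <<s [set E | exists x y (S : set R), measurable S /\
          (E = [set A | S (complex.Re (A x y))] \/ E = [set A | S (complex.Im (A x y))])] >>.

Section Ensembles.
Context {d : measure_display} {Om : measurableType d}.
Definition q_meas_op (X : Om -> opn) : Prop :=
  forall x y, measurable_fun setT (fun w => complex.Re (X w x y)) /\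
              measurable_fun setT (fun w => complex.Im (X w x y)).
Definition q_locally_scrambling (P : probability Om R) (V : Om -> opn) : Prop :=
  forall c : 'I_n -> q_op1, (forall k, q_clifford1 (c k)) ->
  forall A, q_opsigma A ->
    P (V @^-1` A) = P ((fun w => q_opmul (q_tens c) (V w)) @^-1` A).
End Ensembles.

Definition q_expect2 {dU dV : measure_display} {OmU : measurableType dU}
  {OmV : measurableType dV} (PU : probability OmU R) (PV : probability OmV R)
  (X : OmU -> OmV -> R) : R :=
  Rintegral PU setT (fun a => Rintegral PV setT (fun b => X a b)).
Definition q_variance2 {dU dV : measure_display} {OmU : measurableType dU}
  {OmV : measurableType dV} (PU : probability OmU R) (PV : probability OmV R)
  (X : OmU -> OmV -> R) : R :=
  q_expect2 PU PV (fun a b => X a b ^+ 2) - (q_expect2 PU PV X) ^+ 2.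

End NQubits.
End Qubits.

(* Main.v *)
(* The bound holds pointwise in (U, V), before averaging.  Put rho = V rho0 V^*, phi = u theta and
   R = cos phi - i sin phi G; then dC/dtheta = u Tr[rho M] with
   M = i [G, R^* U^* O U R].  M acts on Gamma only and G M G = - M, so rho may be
   replaced by the part (rho_Gamma - G rho_Gamma G) / 2 of its reduced state, which
   is the effective reduced state minus the maximally mixed state.  Cauchy-Schwarz
   for the Frobenius inner product concludes, since each of the 2^|Gamma| columns
   of M has squared norm at most 4 |O|^2. *)
Require Import Defs.
From HB Require Import structures.
From mathcomp Require Import all_boot all_order all_algebra.
From mathcomp Require Import all_classical all_reals all_analysis.
From mathcomp Require Import measurable_realfun complex ring lra.
Import Order.TTheory GRing.Theory Num.Theory.
Local Open Scope ring_scope.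
Local Open Scope classical_set_scope.

(** Cyclicity of the trace moves G M G = - M onto the state: Tr[G rho G M] = Tr[rho G M G] = -
    Tr[rho M], so taking half the difference loses nothing. Conjugation by G multiplies each Pauli
    string by +1 or -1, hence (rho - G rho G) / 2 keeps exactly the strings anticommuting with G.
    The operator norm of O lives on all n qubits, while the dimension factor must be 2^|Gamma|.
    Columns reconcile the two: a column of an operator on Gamma, padded by zeros, is a column of its
    extension by the identity, and a column of O Z with Z unitary is the image under O of a unit
    vector. M is a difference of two terms with columns of norm at most |O|, whence 4 |O|^2 per
    column and 2^(|Gamma| + 2) in total. *)

Lemma sum_mul_sqr_le {R : realType} {I : finType} (a b : I -> R) :
  (\sum_i a i * b i) ^+ 2 <= (\sum_i a i ^+ 2) * (\sum_i b i ^+ 2).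
Proof.
(* Lagrange's identity; summing over ordered pairs counts each square twice, hence the factor 2. *)
have lagrange : \sum_i \sum_j (a i * b j - a j * b i) ^+ 2 =
  2 * ((\sum_i a i ^+ 2) * (\sum_i b i ^+ 2) - (\sum_i a i * b i) ^+ 2).
  have -> : 2 * ((\sum_i a i ^+ 2) * (\sum_i b i ^+ 2) - (\sum_i a i * b i) ^+ 2) =
      (\sum_i a i ^+ 2) * (\sum_i b i ^+ 2) + (\sum_i b i ^+ 2) * (\sum_i a i ^+ 2)
      - 2 * ((\sum_i a i * b i) * (\sum_i a i * b i)) by ring.
  rewrite !big_distrlr /= mulr_sumr -sumrN -!big_split /=.
  apply: eq_bigr => i _; rewrite mulr_sumr -sumrN -!big_split /=.
  by apply: eq_bigr => j _; ring.
rewrite -subr_ge0 -(pmulr_rge0 _ (ltr0n R 2)) -lagrange.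
by apply: sumr_ge0 => i _; apply: sumr_ge0 => j _; exact: sqr_ge0.
Qed.

(** * Operators as matrices, column norms and the operator norm *)

Section OperatorAlgebra.
Set Implicit Arguments. Unset Strict Implicit. Unset Printing Implicit Defensive.
Variables (R : realType) (Q : finType).
Local Notation C := R[i].
Local Notation op := (q_op R Q).
Local Notation N := #|q_basis Q|.
Implicit Types A B G W Z O : op.

Lemma q_cabs_ge0 (z : C) : 0 <= q_cabs z.
Proof. exact: sqrtr_ge0. Qed.

Lemma q_cabs_sqr (z : C) : q_cabs z ^+ 2 = complex.Re z ^+ 2 + complex.Im z ^+ 2.
Proof. by rewrite sqr_sqrtr // addr_ge0 ?sqr_ge0. Qed.

Lemma q_cabsE (z : C) : real_complex R (q_cabs z) = `|z|.
Proof. by rewrite normc_def. Qed.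

Lemma q_cabs_sqrE (z : C) : real_complex R (q_cabs z ^+ 2) = conjc z * z.
Proof. by rewrite rmorphXn /= q_cabsE sqr_normc mulrC. Qed.

Lemma Re_sum (I : Type) (r : seq I) (P : pred I) (F : I -> C) :
  complex.Re (\sum_(i <- r | P i) F i) = \sum_(i <- r | P i) complex.Re (F i).
Proof. by elim/big_rec2: _ => // i y1 y2 _ <-; case: (F i) y2 => a b [c d]. Qed.

Lemma q_cabs_sum (I : finType) (F : I -> C) :
  q_cabs (\sum_i F i) <= \sum_i q_cabs (F i).
Proof.
rewrite -lecR q_cabsE rmorph_sum /= (le_trans (ler_norm_sum _ _ _)) //.
by apply: ler_sum => i _; rewrite q_cabsE.
Qed.

Lemma q_cabsM (z w : C) : q_cabs (z * w) = q_cabs z * q_cabs w.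
Proof. by apply: (@complexI R); rewrite rmorphM /= !q_cabsE normrM. Qed.

(** Bare functions carry no ring structure; transporting operators to square matrices gives access
    to associativity, distributivity and one-sided inverses. *)
Definition q_mx A : 'M[C]_N := \matrix_(i, j) A (enum_val i) (enum_val j).

Lemma q_opP A B : (forall x y, A x y = B x y) -> A = B.
Proof. by move=> AB; apply/funext => x; apply/funext => y. Qed.

Lemma q_mx_inj A B : q_mx A = q_mx B -> A = B.
Proof.
move=> /matrixP AB; apply: q_opP => x y.
by have := AB (enum_rank x) (enum_rank y); rewrite !mxE !enum_rankK.
Qed.

Lemma q_mxM A B : q_mx (q_opmul A B) = q_mx A *m q_mx B.
Proof.
apply/matrixP => i j; rewrite !mxE /q_opmul (reindex (fun k : 'I_N => enum_val k)) /=.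
  by apply: eq_bigr => k _; rewrite !mxE.
by apply: onW_bij; exact: enum_val_bij.
Qed.

Lemma q_mxD A B : q_mx (q_opadd A B) = q_mx A + q_mx B.
Proof. by apply/matrixP => i j; rewrite !mxE. Qed.

Lemma q_mxB A B : q_mx (q_opsub A B) = q_mx A - q_mx B.
Proof. by apply/matrixP => i j; rewrite !mxE. Qed.

Lemma q_mxZ (c : C) A : q_mx (q_opscale c A) = c *: q_mx A.
Proof. by apply/matrixP => i j; rewrite !mxE. Qed.

Lemma q_mx1 : q_mx (@q_opI R Q) = 1%:M.
Proof.
apply/matrixP => i j; rewrite !mxE /q_opI.
by rewrite (inj_eq enum_val_inj).
Qed.

Lemma q_mxadj A : q_mx (q_opadj A) = map_mx conjc (q_mx A)^T.
Proof. by apply/matrixP => i j; rewrite !mxE. Qed.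

Lemma q_mxtr A : \tr (q_mx A) = q_optr A.
Proof.
rewrite /mxtrace /q_optr (reindex (fun k : 'I_N => enum_val k)) /=.
  by apply: eq_bigr => k _; rewrite !mxE.
by apply: onW_bij; exact: enum_val_bij.
Qed.

Lemma q_unitary_mx A : q_unitary A -> q_mx (q_opadj A) *m q_mx A = 1%:M.
Proof. by move=> uA; rewrite -q_mxM -q_mx1; congr q_mx; exact: q_opP. Qed.

Lemma q_mx_unitary A : q_mx (q_opadj A) *m q_mx A = 1%:M -> q_unitary A.
Proof. by rewrite -q_mxM -q_mx1 => /q_mx_inj uA x y; rewrite uA. Qed.

Lemma q_opadjM A B : q_opadj (q_opmul A B) = q_opmul (q_opadj B) (q_opadj A).
Proof.
apply: q_opP => x y; rewrite /q_opadj /q_opmul rmorph_sum.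
by apply: eq_bigr => z _; rewrite rmorphM mulrC.
Qed.

Lemma q_opadjK A : q_opadj (q_opadj A) = A.
Proof. by apply: q_opP => x y; rewrite /q_opadj conjcK. Qed.

Lemma q_unitaryM A B : q_unitary A -> q_unitary B -> q_unitary (q_opmul A B).
Proof.
move=> /q_unitary_mx uA /q_unitary_mx uB; apply: q_mx_unitary.
by rewrite q_opadjM !q_mxM mulmxA -(mulmxA (q_mx (q_opadj B))) uA mulmx1 uB.
Qed.

(** [q_unitary] only asks for a left inverse; for square matrices it is also a right inverse. *)
Lemma q_unitary_adj A : q_unitary A -> q_unitary (q_opadj A).
Proof.
by move=> /q_unitary_mx uA; apply: q_mx_unitary; rewrite q_opadjK mulmx1C.
Qed.

Definition colsq A y : R := \sum_x q_cabs (A x y) ^+ 2.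

Lemma colsqE A y : real_complex R (colsq A y) = q_opmul (q_opadj A) A y y.
Proof.
by rewrite /colsq rmorph_sum /=; apply: eq_bigr => x _; rewrite q_cabs_sqrE.
Qed.

Lemma colsq_unitary Z y : q_unitary Z -> colsq Z y = 1.
Proof.
move=> uZ; apply: (@complexI R); rewrite colsqE uZ /q_opI eqxx.
by rewrite rmorph1.
Qed.

Lemma colsq_unitaryM Z W y : q_unitary Z -> colsq (q_opmul Z W) y = colsq W y.
Proof.
move=> /q_unitary_mx uZ; apply: (@complexI R); rewrite !colsqE.
suff -> : q_opmul (q_opadj (q_opmul Z W)) (q_opmul Z W) = q_opmul (q_opadj W) W by [].
apply: q_mx_inj; rewrite q_opadjM !q_mxM mulmxA.
by rewrite -(mulmxA (q_mx (q_opadj W))) uZ mulmx1.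
Qed.

(** The defect is the squared norm of the same column of A + B (parallelogram law). *)
Lemma colsqB_le A B y : colsq (q_opsub A B) y <= 2 * colsq A y + 2 * colsq B y.
Proof.
rewrite /colsq !mulr_sumr -big_split /=; apply: ler_sum => x _.
rewrite /q_opsub !q_cabs_sqr; case: (A x y) (B x y) => a b [c d] /=.
have := sqr_ge0 (a + c); have := sqr_ge0 (b + d); nra.
Qed.

(** [sup] is a meaningful least upper bound only for a nonempty bounded set, so both must be checked
    before [q_opnorm] can bound anything. *)
Lemma q_opnorm_has_sup O :
  has_sup [set q_vnorm (q_opapply O v) | v in [set v | q_vnorm v = 1]].
Proof.
split.
  exists (q_vnorm (q_opapply O (fun x => (@q_opI R Q) x [ffun => false]))).
  exists (fun x => (@q_opI R Q) x [ffun => false]) => //=.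
  rewrite /q_vnorm -[X in Num.sqrt X]/(colsq (@q_opI R Q) [ffun => false]).
  rewrite colsq_unitary ?sqrtr1 //.
  apply: q_mx_unitary; rewrite q_mx1 mulmx1.
  by rewrite q_mxadj q_mx1 trmx1 map_mx1.
(* A crude bound suffices: the coordinates of a unit vector have modulus at most 1, so each output
   coordinate is at most an absolute row sum. *)
exists (Num.sqrt (\sum_x (\sum_y q_cabs (O x y)) ^+ 2)) => _ [v /= v1 <-].
apply: ler_wsqrtr; apply: ler_sum => x _.
rewrite ler_pXn2r ?nnegrE ?q_cabs_ge0 ?sumr_ge0 // => [|y _]; last exact: q_cabs_ge0.
rewrite (le_trans (q_cabs_sum _)) //; apply: ler_sum => y _.
rewrite q_cabsM ler_piMr ?q_cabs_ge0 //.
rewrite -(@ler_pXn2r _ 2) ?nnegrE ?q_cabs_ge0 // expr1n.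
have : \sum_x q_cabs (v x) ^+ 2 = 1.
  rewrite -[LHS]sqr_sqrtr ?sumr_ge0 // => [|z _]; last exact: sqr_ge0.
  by move: v1; rewrite /q_vnorm => ->; rewrite expr1n.
rewrite (bigD1 y) //= => <-; rewrite lerDl sumr_ge0 // => z _; exact: sqr_ge0.
Qed.

Lemma colsq_opnorm_le O Z y : q_unitary Z -> colsq (q_opmul O Z) y <= q_opnorm O ^+ 2.
Proof.
move=> uZ; have c0 : 0 <= colsq (q_opmul O Z) y.
  by apply: sumr_ge0 => x _; exact: sqr_ge0.
rewrite -[leLHS]sqr_sqrtr // ler_pXn2r ?nnegrE ?sqrtr_ge0 //; last first.
  (* Side condition that [q_opnorm O] is nonnegative, read off from the same unit vector, column [y]
     of [Z]. *)
  apply: (le_trans (sqrtr_ge0 (colsq (q_opmul O Z) y))).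
  apply: sup_upper_bound; first exact: q_opnorm_has_sup.
  exists (fun x => Z x y) => //=.
  by rewrite /q_vnorm -[X in Num.sqrt X]/(colsq Z y) colsq_unitary ?sqrtr1.
apply: sup_upper_bound; first exact: q_opnorm_has_sup.
exists (fun x => Z x y) => //=.
by rewrite /q_vnorm -[X in Num.sqrt X]/(colsq Z y) colsq_unitary ?sqrtr1.
Qed.

Lemma Re_trM_sqr_le A B :
  complex.Re (q_optr (q_opmul A B)) ^+ 2 <=
  (\sum_x \sum_y q_cabs (A x y) ^+ 2) * (\sum_y colsq B y).
Proof.
(* Complex matrices become real vectors, the boolean selecting real or imaginary part. The minus
   sign in [b] turns Re (z w) = Re z Re w - Im z Im w into a real inner product. *)
pose a (i : bool * (q_basis Q * q_basis Q)) : R :=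
  if i.1 then complex.Re (A i.2.1 i.2.2) else complex.Im (A i.2.1 i.2.2).
pose b (i : bool * (q_basis Q * q_basis Q)) : R :=
  if i.1 then complex.Re (B i.2.2 i.2.1) else - complex.Im (B i.2.2 i.2.1).
have sumE (F : bool * (q_basis Q * q_basis Q) -> R) :
    \sum_i F i = \sum_x \sum_y (F (true, (x, y)) + F (false, (x, y))).
  rewrite pair_bigA /= (eq_bigr (fun p => F (true, p) + F (false, p))) => [|[]//].
  rewrite big_split /=.
  rewrite (eq_bigr (fun p => F (p.1, p.2))) => [|[]//].
  by rewrite -(pair_bigA _ (fun h p => F (h, p))) /= big_bool.
have := sum_mul_sqr_le a b; rewrite !sumE /a /b /=.
congr (_ ^+ 2 <= _ * _).
- rewrite /q_optr Re_sum; apply: eq_bigr => x _.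
  rewrite /q_opmul Re_sum; apply: eq_bigr => y _.
  by case: (A x y) (B y x) => p q [r t] /=; ring.
- by apply: eq_bigr => x _; apply: eq_bigr => y _; rewrite q_cabs_sqr.
- rewrite /colsq; apply: eq_bigr => x _; apply: eq_bigr => y _.
  by rewrite q_cabs_sqr sqrrN.
Qed.

End OperatorAlgebra.

(** * Commutation and completeness of Pauli strings *)

Section PauliStrings.
Set Implicit Arguments. Unset Strict Implicit. Unset Printing Implicit Defensive.
Variables (R : realType).
Local Notation C := R[i].

Lemma complex_iE : ('i : C) = Complex 0 1.
Proof. by []. Qed.

Lemma complex_eqP (z w : C) :
  complex.Re z = complex.Re w -> complex.Im z = complex.Im w -> z = w.
Proof. by case: z w => a b [c d] /= -> ->. Qed.

Lemma q_sigma_sq (a : 'I_4) b c : q_mul1 (q_sigma R a) (q_sigma R a) b c = q_id1 R b c.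
Proof.
rewrite /q_mul1 big_bool /q_id1 /q_sigma.
by case: a => [[|[|[|[|//]]]]] i; case: b; case: c;
  rewrite /= ?complex_iE; apply: complex_eqP => /=; ring.
Qed.

Lemma q_sigma_adj (a : 'I_4) b c : conjc (q_sigma R a c b) = q_sigma R a b c.
Proof.
rewrite /q_sigma.
by case: a => [[|[|[|[|//]]]]] i; case: b; case: c;
  rewrite /= ?complex_iE; apply: complex_eqP => /=; ring.
Qed.

(** Two single-qubit Pauli matrices anticommute exactly when they are distinct and neither is the
    identity. *)
Definition sigma_sign (a b : 'I_4) : bool :=
  [&& val a != 0%N, val b != 0%N & val a != val b].

Lemma q_sigma_comm (a b : 'I_4) c d :
  q_mul1 (q_sigma R a) (q_sigma R b) c d =
  (-1) ^+ sigma_sign a b * q_mul1 (q_sigma R b) (q_sigma R a) c d.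
Proof.
rewrite /q_mul1 !big_bool /sigma_sign /q_sigma.
by case: a b => [[|[|[|[|//]]]]] i [[|[|[|[|//]]]]] j; case: c; case: d;
  rewrite /= ?complex_iE; apply: complex_eqP => /=; ring.
Qed.

(** Entrywise form of the fact that the sum of sigma_a (x) sigma_a over a is twice the swap
    operator. *)
Lemma q_sigma_complete b c d e :
  \sum_a q_sigma R a b c * q_sigma R a d e = 2 * ((b == e) && (c == d))%:R.
Proof.
rewrite !big_ord_recl big_ord0 /q_sigma.
by case: b; case: c; case: d; case: e;
  rewrite /= ?complex_iE; apply: complex_eqP => /=; ring.
Qed.

Variable Q : finType.
Local Notation op := (q_op R Q).
Implicit Types (A G rho : op) (p q : q_pstring Q).

Lemma prod_bool_natr (b : Q -> bool) :
  \prod_k (b k)%:R = ([forall k, b k])%:R :> C.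
Proof.
have [/forallP bT|/forallPn[k /negbTE bk]] := boolP [forall k, b k].
  by rewrite big1 // => k _; rewrite bT.
by rewrite (bigD1 k) //= bk mul0r.
Qed.

Lemma q_tensM (c d : Q -> q_op1 R) :
  q_opmul (q_tens c) (q_tens d) = q_tens (fun k => q_mul1 (c k) (d k)).
Proof.
apply: q_opP => x y; rewrite /q_tens /q_mul1 bigA_distr_bigA /=.
by apply: eq_bigr => z _; rewrite -big_split.
Qed.

Lemma q_opI_tens : @q_opI R Q = q_tens (fun=> q_id1 R).
Proof.
apply: q_opP => x y; rewrite /q_tens /q_id1 prod_bool_natr /q_opI.
congr (nat_of_bool _)%:R; apply/eqP/forallP => [->//|xy].
by apply/ffunP => k; apply/eqP.
Qed.

Lemma q_pauliE p : q_pauli R p = q_tens (fun k => q_sigma R (p k)).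
Proof. by []. Qed.

Lemma q_pauli_sq p : q_opmul (q_pauli R p) (q_pauli R p) = @q_opI R Q.
Proof.
rewrite q_pauliE q_tensM q_opI_tens; apply: q_opP => x y.
by apply: eq_bigr => k _; exact: q_sigma_sq.
Qed.

Lemma q_pauli_adj p : q_opadj (q_pauli R p) = q_pauli R p.
Proof.
apply: q_opP => x y; rewrite /q_opadj /q_pauli rmorph_prod.
by apply: eq_bigr => k _; exact: q_sigma_adj.
Qed.

(** The sign is the product of the qubitwise signs. Only its existence is recorded, because
    [q_anticommuteb] determines later which sign it is. *)
Lemma q_pauli_comm p q : exists s : bool,
  q_opmul (q_pauli R p) (q_pauli R q) =
  q_opscale ((-1) ^+ s) (q_opmul (q_pauli R q) (q_pauli R p)).
Proof.
have sgnE (r : seq Q) : exists s : bool,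
    \prod_(k <- r) (-1) ^+ sigma_sign (p k) (q k) = (-1) ^+ s :> C.
  elim: r => [|k r [s IH]]; first by exists false; rewrite big_nil.
  by exists (sigma_sign (p k) (q k) (+) s); rewrite big_cons IH signr_addb.
have [s sE] := sgnE (index_enum Q).
exists s; rewrite !q_pauliE !q_tensM; apply: q_opP => x y.
rewrite /q_opscale -sE -big_split /=.
by apply: eq_bigr => k _; exact: q_sigma_comm.
Qed.

Lemma q_pauli_complete (x y z w : q_basis Q) :
  \sum_(p : q_pstring Q) q_pauli R p x y * q_pauli R p z w = 2 ^+ #|Q| * ((x == w) && (y == z))%:R.
Proof.
under eq_bigr => p _ do rewrite /q_pauli -big_split /=.
rewrite -(bigA_distr_bigA
  (fun (k : Q) (a : 'I_4) => q_sigma R a (x k) (y k) * q_sigma R a (z k) (w k))) /=.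
under eq_bigr => k _ do rewrite q_sigma_complete.
rewrite big_split /= prodr_const prod_bool_natr; congr (_ * (nat_of_bool _)%:R).
apply/forallP/andP => [xyzw|[/eqP-> /eqP->] k]; last by rewrite !eqxx.
by split; apply/eqP/ffunP => k; have /andP[/eqP ? /eqP ?] := xyzw k.
Qed.

(** Expand the trace and sum over the strings first: completeness leaves only the term a = y, b =
    x. *)
Lemma q_pauli_expansion rho x y :
  \sum_(p : q_pstring Q) q_optr (q_opmul (q_pauli R p) rho) * q_pauli R p x y = 2 ^+ #|Q| * rho x y.
Proof.
under eq_bigr => p _.
  rewrite /q_optr /q_opmul mulr_suml.
  under eq_bigr => a _ do (rewrite mulr_suml; under eq_bigr => b _ do rewrite mulrAC).
  over.
rewrite exchange_big (bigD1 y) //= exchange_big (bigD1 x) //=.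
rewrite -mulr_suml q_pauli_complete !eqxx mulr1 big1 ?addr0 => [|b bx]; last first.
  by rewrite -mulr_suml q_pauli_complete (negPf bx) andbF mulr0 mul0r.
rewrite big1 ?addr0 // => a ay; rewrite exchange_big big1 // => b _.
by rewrite -mulr_suml q_pauli_complete (negPf ay) mulr0 mul0r.
Qed.

(* [rho |-> (rho - G rho G) / 2] is the projection onto the span of the Pauli
   strings anticommuting with [G]; the identity string never contributes. *)
Lemma q_pauli_anti_projection q (sgn : bool) rho x y :
  let G := q_opscale ((-1) ^+ sgn) (q_pauli R q) in
  (2 ^ #|Q|)%:R^-1 *
    (\sum_(p | (p != q_pid Q) && q_anticommuteb (q_pauli R p) G)
      q_optr (q_opmul (q_pauli R p) rho) * q_pauli R p x y) =
  2^-1 * (rho x y - q_opmul (q_opmul G rho) G x y).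
Proof.
move=> G.
have GG : q_opmul G G = @q_opI R Q.
  apply: q_mx_inj; rewrite q_mxM !q_mxZ -scalemxAl -scalemxAr scalerA -signr_addb addbb.
  by rewrite expr0 scale1r -q_mxM q_pauli_sq.
have GC p : exists s : bool,
    q_opmul G (q_pauli R p) = q_opscale ((-1) ^+ s) (q_opmul (q_pauli R p) G).
  have [s pq] := q_pauli_comm q p; exists s.
  apply: q_mx_inj; rewrite !(q_mxZ, q_mxM) -scalemxAl -scalemxAr -q_mxM pq q_mxZ q_mxM.
  by rewrite !scalerA mulrC.
clearbody G.
(* From here on [G] enters only through G^2 = 1 and its commutation with each string up to a
   sign. *)
have conjP p : q_opmul (q_opmul G (q_pauli R p)) G =
    q_opscale ((-1) ^+ (q_anticommuteb (q_pauli R p) G)) (q_pauli R p).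
  have [s Gp] := GC p.
  suff sE : (-1) ^+ s = (-1) ^+ (q_anticommuteb (q_pauli R p) G) :> C.
    rewrite Gp sE; apply: q_mx_inj; rewrite !(q_mxZ, q_mxM) -scalemxAl -mulmxA.
    by rewrite -[q_mx G *m _]q_mxM GG q_mx1 mulmx1.
  have [/forallP anti|] := boolP (q_anticommuteb _ _).
    (* A string that both commutes and anticommutes with [G] would satisfy 2 P G = 0, although P G
       is invertible. *)
    case: s Gp => // Gp; exfalso.
    have pG0 : q_opmul (q_pauli R p) G = fun=> fun=> 0.
      apply: q_opP => a b; have := anti a => /forallP/(_ b).
      by rewrite Gp /q_opscale expr0 mul1r -mulr2n mulrn_eq0 => /eqP.
    have : q_opmul (q_opmul (q_pauli R p) (q_opmul (q_pauli R p) G)) G = @q_opI R Q.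
      apply: q_mx_inj; rewrite !q_mxM mulmxA -q_mxM q_pauli_sq q_mx1 mul1mx.
      by rewrite -q_mxM GG q_mx1.
    rewrite pG0 => /(congr1 (fun A => A [ffun=> false] [ffun=> false])).
    rewrite /q_opmul /q_opI eqxx big1 => [/esym/eqP|a _]; first by rewrite oner_eq0.
    by rewrite big1 ?mul0r // => b _; rewrite mulr0.
  case: s Gp => // Gp /negP[]; apply/forallP => a; apply/forallP => b.
  by rewrite Gp /q_opscale expr1 mulN1r subrr.
have pidF : ~~ q_anticommuteb (q_pauli R (q_pid Q)) G.
  apply/negP => anti; have := conjP (q_pid Q); rewrite anti expr1.
  have -> : q_pauli R (q_pid Q) = @q_opI R Q.
    by rewrite q_opI_tens; apply: q_opP => a b; apply: eq_bigr => k _; rewrite ffunE.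
  have -> : q_opmul (q_opmul G (@q_opI R Q)) G = @q_opI R Q.
    by apply: q_mx_inj; rewrite !q_mxM q_mx1 mulmx1 -q_mxM GG q_mx1.
  move=> /(congr1 (fun A => A [ffun=> false] [ffun=> false])).
  rewrite /q_opscale /q_opI eqxx => /eqP.
  by rewrite mulN1r -subr_eq0 opprK -[1 + 1]/(2%:R) pnatr_eq0.
have -> : rho x y = (2 ^+ #|Q|)^-1 *
    \sum_(p : q_pstring Q) q_optr (q_opmul (q_pauli R p) rho) * q_pauli R p x y.
  by rewrite q_pauli_expansion mulKf // expf_neq0 // pnatr_eq0.
have -> : q_opmul (q_opmul G rho) G x y = (2 ^+ #|Q|)^-1 *
    \sum_(p : q_pstring Q) q_optr (q_opmul (q_pauli R p) rho) * q_opmul (q_opmul G (q_pauli R p)) G x y.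
  apply: (@mulfI _ (2 ^+ #|Q|)); first by rewrite expf_neq0 // pnatr_eq0.
  rewrite mulVKf ?expf_neq0 ?pnatr_eq0 //.
  under [RHS]eq_bigr => p _ do rewrite /q_opmul mulr_sumr.
  rewrite exchange_big /= /q_opmul mulr_sumr; apply: eq_bigr => b _.
  under [RHS]eq_bigr => p _ do rewrite mulrA mulr_sumr mulr_suml.
  rewrite exchange_big /= mulrA mulr_sumr mulr_suml; apply: eq_bigr => a _.
  under [RHS]eq_bigr => p _ do rewrite mulrCA.
  rewrite -mulr_suml -mulr_sumr q_pauli_expansion; ring.
rewrite -mulrBr -sumrB mulrCA natrX; congr (_ * _).
(* In the expansion of rho - G rho G, commuting strings cancel and anticommuting ones double, which
   the factor 1/2 undoes. *)
rewrite mulr_sumr [RHS](bigID (fun p => (p != q_pid Q) && q_anticommuteb (q_pauli R p) G)) /=.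
rewrite [X in _ = _ + X]big1 ?addr0 => [|p /nandP pN].
  apply: eq_bigr => p /andP[_ anti]; rewrite conjP anti /q_opscale.
  by field.
rewrite conjP; case: pN => [/negPn/eqP->|/negPf->].
  by rewrite (negPf pidF) /q_opscale expr0 mul1r subrr mulr0.
by rewrite /q_opscale expr0 mul1r subrr mulr0.
Qed.

End PauliStrings.

(** * Rotations generated by an involution, and the gradient observable *)

Section Rotations.
Import numFieldNormedType.Exports.
Set Implicit Arguments. Unset Strict Implicit. Unset Printing Implicit Defensive.
Variables (R : realType) (Q : finType).
Local Notation C := R[i].
Local Notation op := (q_op R Q).
Implicit Types (A G O rho : op) (c s phi : R).

(** Closed form of exp(-i phi G) for G^2 = 1, with the cosine and sine as free parameters so that
    the algebra needs at most c^2 + s^2 = 1. *)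
Definition q_rot c s G : op :=
  q_opsub (q_opscale (real_complex R c) (@q_opI R Q)) (q_opscale ('i * real_complex R s) G).

(* For [G] with [G ^ 2 = 1], this is the Hermitian operator
   [i [G, R^* O R]] with [R = q_rot c s G], i.e. the derivative of [R^* O R] in the
   angle whose cosine and sine are [c] and [s]. *)
Definition q_grad c s G O : op :=
  q_opadd
    (q_opscale (real_complex R (2 * s * c)) (q_opsub (q_opmul (q_opmul G O) G) O))
    (q_opscale (real_complex R (c ^+ 2 - s ^+ 2) * 'i)
      (q_opsub (q_opmul G O) (q_opmul O G))).

Lemma q_oppow_scale (z : C) G k :
  q_oppow (q_opscale z G) k = q_opscale (z ^+ k) (q_oppow G k).
Proof.
elim: k => [|k IH]; first by apply: q_opP => x y; rewrite /q_opscale expr0 mul1r.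
rewrite /q_oppow iterS -/(q_oppow _ k) IH; apply: q_mx_inj.
by rewrite iterS !(q_mxM, q_mxZ) -scalemxAl -scalemxAr scalerA exprS.
Qed.

Lemma q_oppow_involution G k : q_opmul G G = @q_opI R Q ->
  q_oppow G k = if odd k then G else @q_opI R Q.
Proof.
move=> GG; elim: k => // k IH; rewrite /q_oppow iterS -/(q_oppow _ k) IH /=.
case: (odd k) => //=; apply: q_mx_inj.
by rewrite q_mxM q_mx1 mulmx1.
Qed.

(** [cos_coeff] and [sin_coeff] vanish at odd and even indices respectively, so all three series
    share the index [k] and the comparison is termwise, by parity. *)
Lemma exp_coeff_term phi G k x y : q_opmul G G = @q_opI R Q ->
  (k`!)%:R^-1 * q_oppow (q_opscale (- 'i * real_complex R phi) G) k x y =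
  real_complex R (cos_coeff phi k) * @q_opI R Q x y -
  'i * real_complex R (sin_coeff phi k) * G x y.
Proof.
move=> GG; rewrite q_oppow_scale q_oppow_involution // /q_opscale exprMn /cos_coeff /sin_coeff /=.
have fE : ((k`!)%:R^-1 : C) = real_complex R ((k`!)%:R^-1) by rewrite fmorphV rmorph_nat.
have iE m : (- 'i : C) ^+ (m.*2) = (-1) ^+ m.
  by rewrite -mul2n exprM sqrrN sqrCi.
rewrite fE -(odd_double_half k); move: (k./2) => m; case: (odd k) => /=.
  rewrite add1n /= odd_double /= doubleK mul0r mul0r mul0r rmorph0 mul0r sub0r mul1r.
  rewrite exprS iE !rmorphM /= !rmorphXn /= rmorphN1; ring.
rewrite add0n odd_double /= doubleK !mul0r rmorph0 mulr0 mul0r subr0 mul1r iE.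
rewrite !rmorphM /= -exprnP !rmorphXn /= rmorphN1; ring.
Qed.

Lemma q_expm_involution phi G : q_opmul G G = @q_opI R Q ->
  q_expm (q_opscale (- 'i * real_complex R phi) G) = q_rot (cos phi) (sin phi) G.
Proof.
move=> GG; apply: q_opP => x y; rewrite /q_expm.
pose a := @q_opI R Q x y; pose b := G x y.
have cosC : series (cos_coeff phi) n @[n --> \oo] --> cos phi.
  by rewrite unlock; exact: is_cvg_series_cos_coeff.
have sinC : series (sin_coeff phi) n @[n --> \oo] --> sin phi.
  by rewrite unlock; exact: is_cvg_series_sin_coeff.
rewrite /q_rot /q_opsub /q_opscale -/a -/b; apply: complex_eqP => /=.
- apply/cvg_lim => //.
  rewrite [X in X @ _ --> _](_ : _ = (fun n => complex.Re a * series (cos_coeff phi) n +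
      complex.Im b * series (sin_coeff phi) n)); last first.
    apply/funext => n; rewrite /series /= !mulr_sumr -big_split /= big_mkord.
    apply: eq_bigr => k _; rewrite exp_coeff_term // -/a -/b complex_iE.
    by case: a b => [a1 a2] [b1 b2] /=; ring.
  have -> : complex.Re (real_complex R (cos phi) * a - 'i * real_complex R (sin phi) * b) =
     complex.Re a * cos phi + complex.Im b * sin phi.
    by rewrite complex_iE; case: a b => [a1 a2] [b1 b2] /=; ring.
  by apply: cvgD; apply: cvgMr.
- apply/cvg_lim => //.
  rewrite [X in X @ _ --> _](_ : _ = (fun n => complex.Im a * series (cos_coeff phi) n -
      complex.Re b * series (sin_coeff phi) n)); last first.
    apply/funext => n; rewrite /series /= !mulr_sumr -sumrB big_mkord.
    apply: eq_bigr => k _; rewrite exp_coeff_term // -/a -/b complex_iE.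
    by case: a b => [a1 a2] [b1 b2] /=; ring.
  have -> : complex.Im (real_complex R (cos phi) * a - 'i * real_complex R (sin phi) * b) =
     complex.Im a * cos phi - complex.Re b * sin phi.
    by rewrite complex_iE; case: a b => [a1 a2] [b1 b2] /=; ring.
  by apply: cvgB; apply: cvgMr.
Qed.

Lemma q_mx_rot c s G :
  q_mx (q_rot c s G) = real_complex R c *: 1%:M - ('i * real_complex R s) *: q_mx G.
Proof. by rewrite q_mxB !q_mxZ q_mx1. Qed.

Lemma q_mx_rot_adj c s G : q_opadj G = G ->
  q_mx (q_opadj (q_rot c s G)) =
  real_complex R c *: 1%:M + ('i * real_complex R s) *: q_mx G.
Proof.
move=> GA; rewrite -q_mx1 -!q_mxZ -q_mxD; congr q_mx; apply: q_opP => x y.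
have -> : q_opadd (q_opscale (real_complex R c) (@q_opI R Q))
    (q_opscale ('i * real_complex R s) G) x y =
  q_opadd (q_opscale (real_complex R c) (@q_opI R Q))
    (q_opscale ('i * real_complex R s) (q_opadj G)) x y by rewrite GA.
rewrite /q_opadj /q_rot /q_opsub /q_opscale /q_opadd /q_opI eq_sym complex_iE.
case: (G y x) (x == y) => a b [] /=; apply: complex_eqP => /=; ring.
Qed.

Lemma q_rot_unitary c s G : q_opadj G = G -> q_opmul G G = @q_opI R Q ->
  c ^+ 2 + s ^+ 2 = 1 -> q_unitary (q_rot c s G).
Proof.
move=> GA /(congr1 (fun A => q_mx A)); rewrite q_mxM q_mx1 => GG cs.
apply: q_mx_unitary; rewrite q_mx_rot_adj // q_mx_rot.
rewrite mulmxBr !mulmxDl -!scalemxAl -!scalemxAr !mul1mx mulmx1 GG.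
rewrite !scalerA; apply/matrixP => i j; rewrite !mxE.
rewrite -[RHS]mul1r -[X in _ = X * _](rmorph1 (real_complex R)) -cs.
rewrite complex_iE; move: (G _ _) => [a b].
by case: (i == j) => /=; apply: complex_eqP => /=; ring.
Qed.

(** The angle enters only through a quadratic form in c and s whose operator coefficients are fixed;
    this makes the cost a scalar trigonometric polynomial. *)
Lemma q_mx_conj_rot c s G O : q_opadj G = G ->
  q_mx (q_opmul (q_opmul (q_opadj (q_rot c s G)) O) (q_rot c s G)) =
  real_complex R (c ^+ 2) *: q_mx O
  + real_complex R (s ^+ 2) *: (q_mx G *m q_mx O *m q_mx G)
  + (real_complex R (s * c) * 'i) *: (q_mx G *m q_mx O - q_mx O *m q_mx G).
Proof.
move=> GA; rewrite !q_mxM q_mx_rot_adj // q_mx_rot.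
rewrite mulmxBr !mulmxDl -!scalemxAl -!scalemxAr !mul1mx !mulmx1.
move: (q_mx O) (q_mx O *m q_mx G) (q_mx G *m q_mx O) (q_mx G *m q_mx O *m q_mx G).
move=> W Z Y X; apply/matrixP => i j; rewrite !mxE complex_iE.
move: (X i j) (Y i j) (Z i j) (W i j) => [x x'] [y y'] [z z'] [w w'].
by apply: complex_eqP => /=; ring.
Qed.

Lemma q_mx_grad c s G O : q_mx (q_grad c s G O) =
  real_complex R (2 * s * c) *: (q_mx G *m q_mx O *m q_mx G - q_mx O) +
  (real_complex R (c ^+ 2 - s ^+ 2) * 'i) *: (q_mx G *m q_mx O - q_mx O *m q_mx G).
Proof. by rewrite q_mxD !q_mxZ !q_mxB !q_mxM. Qed.

(** The expanded form of [q_grad] suits differentiation and localization; this commutator form suits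
    the norm bound. *)
Lemma q_grad_commutator c s G O : q_opadj G = G -> q_opmul G G = @q_opI R Q ->
  let T := q_opmul (q_opmul (q_opadj (q_rot c s G)) O) (q_rot c s G) in
  q_grad c s G O = q_opscale 'i (q_opsub (q_opmul G T) (q_opmul T G)).
Proof.
move=> GA /(congr1 (fun A => q_mx A)); rewrite q_mxM q_mx1 => GG T.
apply: q_mx_inj; rewrite q_mxZ q_mxB !(q_mxM _ T, q_mxM T) /T q_mx_conj_rot // q_mx_grad.
move: (q_mx G) (q_mx O) GG => g o gg.
have ggo : g *m (g *m o) = o by rewrite mulmxA gg mul1mx.
have ogg : o *m g *m g = o by rewrite -mulmxA gg mulmx1.
have ggog : g *m (g *m o *m g) = o *m g by rewrite -mulmxA mulmxA gg mul1mx.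
have gogg : g *m o *m g *m g = g *m o by rewrite -mulmxA gg mulmx1.
rewrite !mulmxDr !mulmxDl -!scalemxAl -!scalemxAr mulmxBr mulmxBl.
rewrite ggog gogg ggo ogg mulmxA.
apply/matrixP => i j.
move: (o *m g) (g *m o) (g *m o *m g) => Z Y X; rewrite !mxE complex_iE.
move: (X i j) (Y i j) (Z i j) (o i j) => [x x'] [y y'] [z z'] [w w'].
by apply: complex_eqP => /=; ring.
Qed.

(** Conjugation by G exchanges G O G with O and G O with O G, so both brackets of [q_grad] change
    sign. *)
Lemma q_grad_anti c s G O : q_opmul G G = @q_opI R Q ->
  q_opmul (q_opmul G (q_grad c s G O)) G = q_opscale (-1) (q_grad c s G O).
Proof.
move=> /(congr1 (fun A => q_mx A)); rewrite q_mxM q_mx1 => GG.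
apply: q_mx_inj; rewrite q_mxZ !(q_mxM G, q_mxM _ G) q_mx_grad.
move: (q_mx G) (q_mx O) GG => g o gg.
have ggo : g *m (g *m o) = o by rewrite mulmxA gg mul1mx.
have ggog : g *m (g *m o *m g) *m g = o.
  by rewrite !mulmxA gg mul1mx -mulmxA gg mulmx1.
have gogg : g *m (o *m g) *m g = g *m o by rewrite -!mulmxA gg mulmx1.
rewrite !mulmxDr !mulmxDl -!scalemxAr -!scalemxAl !mulmxBr !mulmxBl.
rewrite ggog gogg ggo.
apply/matrixP => i j.
move: (o *m g) (g *m o) (g *m o *m g) => Z Y X; rewrite !mxE complex_iE.
move: (X i j) (Y i j) (Z i j) (o i j) => [x x'] [y y'] [z z'] [w w'].
by apply: complex_eqP => /=; ring.
Qed.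

Lemma q_unitary_scale_i A : q_unitary A -> q_unitary (q_opscale 'i A).
Proof.
move=> uA x y; rewrite -uA /q_opmul; apply: eq_bigr => z _.
rewrite /q_opadj /q_opscale complex_iE.
by case: (A z x) (A z y) => p q [r t]; apply: complex_eqP => /=; ring.
Qed.

Lemma colsq_grad_le c s G O U y : q_opadj G = G -> q_opmul G G = @q_opI R Q ->
  c ^+ 2 + s ^+ 2 = 1 -> q_unitary U ->
  colsq (q_grad c s G (q_opmul (q_opmul (q_opadj U) O) U)) y <= 4 * q_opnorm O ^+ 2.
Proof.
move=> GA GG cs uU; rewrite q_grad_commutator //.
set rot := q_rot c s G.
have urot : q_unitary rot by exact: q_rot_unitary.
have uG : q_unitary G by move=> a b; rewrite GA GG.
have uiG := q_unitary_scale_i uG.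
have uir := q_unitary_scale_i (q_unitary_adj (q_unitaryM uU urot)).
set T := q_opmul (q_opmul (q_opadj rot) _) rot.
have TE : T = q_opmul (q_opadj (q_opmul U rot)) (q_opmul O (q_opmul U rot)).
  by apply: q_mx_inj; rewrite /T q_opadjM !q_mxM !mulmxA.
(* With W = U [rot], T is W^* O W. Each term becomes a unitary times O times a unitary: the left
   factor, which absorbs i, preserves column norms, and the right one supplies unit vectors. *)
have -> : q_opscale 'i (q_opsub (q_opmul G T) (q_opmul T G)) =
  q_opsub (q_opmul (q_opmul (q_opscale 'i G) (q_opadj (q_opmul U rot)))
                   (q_opmul O (q_opmul U rot)))
          (q_opmul (q_opscale 'i (q_opadj (q_opmul U rot)))
                   (q_opmul O (q_opmul (q_opmul U rot) G))).
  apply: q_mx_inj; rewrite TE !(q_mxZ, q_mxB, q_mxM) -!scalemxAl scalerBr.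
  by rewrite !mulmxA.
apply: (le_trans (colsqB_le _ _ _)).
rewrite (colsq_unitaryM _ _ uir) colsq_unitaryM; last first.
  by apply: q_unitaryM => //; apply: q_unitary_adj; exact: q_unitaryM.
have := colsq_opnorm_le O y (q_unitaryM uU urot).
have := colsq_opnorm_le O y (q_unitaryM (q_unitaryM uU urot) uG).
lra.
Qed.

End Rotations.

(** * Differentiation of the cost *)

Section CostDerivative.
Import numFieldNormedType.Exports.
Set Implicit Arguments. Unset Strict Implicit. Unset Printing Implicit Defensive.
Variables (R : realType) (n : nat).
Local Notation op := (q_op R 'I_n).
Implicit Types (G O U V rho : op) (u theta : R).

Lemma derive1_trig_quadratic (a b k u theta : R) :
  derive1 (fun t : R => a * cos (u * t) ^+ 2 + b * sin (u * t) ^+ 2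
                    + k * (sin (u * t) * cos (u * t))) theta =
  u * (2 * sin (u * theta) * cos (u * theta) * (b - a)
       + (cos (u * theta) ^+ 2 - sin (u * theta) ^+ 2) * k).
Proof.
have Du : is_derive theta 1 (fun t : R => u * t) u.
  by apply: is_derive_eq; rewrite /GRing.scale /=; ring.
have Dc : is_derive theta 1 (fun t : R => cos (u * t)) (- sin (u * theta) * u).
  exact: (is_derive1_comp (f := cos)).
have Ds : is_derive theta 1 (fun t : R => sin (u * t)) (cos (u * theta) * u).
  exact: (is_derive1_comp (f := sin)).
rewrite derive1E; apply: derive_val.
apply: is_derive_eq; rewrite /GRing.scale /=; ring.
Qed.

Lemma mxtrace_conj (m : nat) (a b v r w b' a' o : 'M[R[i]]_m) :
  \tr (a *m b *m v *m r *m w *m b' *m a' *m o) =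
  \tr (v *m r *m w *m (b' *m (a' *m o *m a) *m b)).
Proof.
have -> : a *m b *m v *m r *m w *m b' *m a' *m o =
          a *m b *m (v *m r *m w *m b' *m a' *m o) by rewrite !mulmxA.
by rewrite mxtrace_mulC !mulmxA.
Qed.

(** Only a scalar function is differentiated: the cost is a cos^2 + b sin^2 + k sin cos, and the
    combinations b - a and k in its derivative are the traces of the state against the two brackets
    of [q_grad]. *)
Lemma q_cost_gradient rho0 O G U V u theta :
  q_opadj G = G -> q_opmul G G = @q_opI R 'I_n ->
  derive1 (q_cost rho0 O G u U V) theta =
  u * complex.Re (q_optr (q_opmul (q_opmul (q_opmul V rho0) (q_opadj V))
    (q_grad (cos (u * theta)) (sin (u * theta)) G
      (q_opmul (q_opmul (q_opadj U) O) U)))).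
Proof.
move=> GA GG.
set rho := q_opmul (q_opmul V rho0) _; set OU := q_opmul (q_opmul _ O) U.
pose tr X := complex.Re (\tr (q_mx rho *m X)).
have trD X Y : tr (X + Y) = tr X + tr Y.
  by rewrite /tr mulmxDr mxtraceD; case: (\tr _) (\tr _) => ? ? [].
have trB X Y : tr (X - Y) = tr X - tr Y.
  have ReB (z w : R[i]) : complex.Re (z - w) = complex.Re z - complex.Re w.
    by case: z w => ? ? [].
  by rewrite /tr mulmxBr (raddfB (@mxtrace _ _)); exact: ReB.
have trZ (z : R[i]) X : tr (z *: X) = complex.Re (z * \tr (q_mx rho *m X)).
  by rewrite /tr -scalemxAr mxtraceZ.
have trZr (z : R) X : tr (real_complex R z *: X) = z * tr X.
  by rewrite trZ /tr; case: (\tr _) => ? ? /=; ring.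
pose a := tr (q_mx OU); pose b := tr (q_mx G *m q_mx OU *m q_mx G).
pose k := tr ('i *: (q_mx G *m q_mx OU - q_mx OU *m q_mx G)).
have -> : q_cost rho0 O G u U V = fun t : R =>
    a * cos (u * t) ^+ 2 + b * sin (u * t) ^+ 2 + k * (sin (u * t) * cos (u * t)).
  apply/funext => t; rewrite /q_cost /q_RG q_expm_involution //.
  set rot := q_rot _ _ _.
  transitivity (tr (q_mx (q_opmul (q_opmul (q_opadj rot) OU) rot))).
    rewrite /tr -q_mxtr; congr (complex.Re _).
    by do 7 rewrite q_mxM; rewrite mxtrace_conj /rho /OU; do 6 rewrite q_mxM.
  rewrite q_mx_conj_rot // !trD -scalerA !trZr -/a -/b -/k.
  by move: a b k => a' b' k'; ring.
rewrite derive1_trig_quadratic; congr (_ * _).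
rewrite -q_mxtr q_mxM q_mx_grad -/(tr _) trD -scalerA !trZr trB.
by rewrite /a /b /k.
Qed.

End CostDerivative.

(** * Operators acting on Gamma only, and the partial trace *)

Section Localization.
Set Implicit Arguments. Unset Strict Implicit. Unset Printing Implicit Defensive.
Variables (R : realType) (n : nat) (Gamma : {set 'I_n}).
Local Notation C := R[i].
Local Notation op := (q_op R 'I_n).
Local Notation opG := (q_op R (q_qsub Gamma)).
Implicit Types (x y z w : q_basis 'I_n) (s t : q_basis (q_qsub Gamma)).

Definition q_agree x y : bool := [forall k, (k \notin Gamma) ==> (x k == y k)].

Definition q_merge s w : q_basis 'I_n :=
  [ffun k => if insub k is Some k' then s k' else w k].

(** The extension of A by the identity outside Gamma, dual to the partial trace ([q_tr_ptrace]). *)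
Definition q_lift (A : opG) : op := fun x y =>
  if q_agree x y then A (q_restr Gamma x) (q_restr Gamma y) else 0.

Lemma q_agreeP x y : reflect (forall k, k \notin Gamma -> x k = y k) (q_agree x y).
Proof.
apply: (iffP forallP) => [xy k kG|xy k]; last by apply/implyP => kG; rewrite xy.
by have /implyP/(_ kG)/eqP := xy k.
Qed.

Lemma q_agree_sym x y : q_agree x y = q_agree y x.
Proof. by apply: eq_forallb => k; rewrite eq_sym. Qed.

Lemma q_agree_congr x y z : q_agree x y -> q_agree x z = q_agree y z.
Proof.
by move=> /q_agreeP xy; apply: eq_forallb_in => k kG; rewrite xy.
Qed.

Lemma q_restr_merge s w : q_restr Gamma (q_merge s w) = s.
Proof. by apply/ffunP => k; rewrite !ffunE valK. Qed.

Lemma q_agree_merge s w : q_agree w (q_merge s w).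
Proof. by apply/q_agreeP => k kG; rewrite ffunE insubN. Qed.

Lemma q_merge_restr x w : q_agree w x -> q_merge (q_restr Gamma x) w = x.
Proof.
move=> /q_agreeP wx; apply/ffunP => k; rewrite !ffunE.
by case: insubP => [k' kG <-|/wx]; rewrite ?ffunE.
Qed.

(** The basis states that agree with [w] outside Gamma are parametrized by their bits on Gamma, with
    inverse [q_merge]. Every passage between global and local sums rests on this. *)
Lemma sum_agree (T : nmodType) w (F : q_basis (q_qsub Gamma) -> T) :
  \sum_(x | q_agree w x) F (q_restr Gamma x) = \sum_s F s.
Proof.
rewrite (reindex_onto (fun s => q_merge s w) (q_restr Gamma)) => [|x]; last first.
  exact: q_merge_restr.
by apply: eq_big => s; rewrite q_restr_merge ?q_agree_merge ?eqxx.
Qed.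

Lemma q_liftM (A B : opG) : q_opmul (q_lift A) (q_lift B) = q_lift (q_opmul A B).
Proof.
apply: q_opP => x y; rewrite /q_opmul /q_lift.
rewrite (bigID (q_agree x)) /= [X in _ + X]big1 ?addr0; last first.
  by move=> z /negPf ->; rewrite mul0r.
case: ifPn => [xy|/negPf xy].
  rewrite -(sum_agree x); apply: eq_bigr => z xz.
  by rewrite xz -(q_agree_congr y xz) xy.
rewrite big1 // => z xz.
by rewrite -(q_agree_congr y xz) xy mulr0.
Qed.

Lemma q_liftD (A B : opG) : q_opadd (q_lift A) (q_lift B) = q_lift (q_opadd A B).
Proof.
by apply: q_opP => x y; rewrite /q_opadd /q_lift; case: ifP; rewrite ?addr0.
Qed.

Lemma q_liftB (A B : opG) : q_opsub (q_lift A) (q_lift B) = q_lift (q_opsub A B).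
Proof.
by apply: q_opP => x y; rewrite /q_opsub /q_lift; case: ifP; rewrite ?subr0.
Qed.

Lemma q_liftZ (c : C) (A : opG) : q_opscale c (q_lift A) = q_lift (q_opscale c A).
Proof.
by apply: q_opP => x y; rewrite /q_opscale /q_lift; case: ifP; rewrite ?mulr0.
Qed.

Lemma q_lift_grad (c s : R) (G O : opG) :
  q_grad c s (q_lift G) (q_lift O) = q_lift (q_grad c s G O).
Proof. by rewrite /q_grad !(q_liftM, q_liftB, q_liftZ, q_liftD). Qed.

Lemma colsq_lift (A : opG) t w : colsq (q_lift A) (q_merge t w) = colsq A t.
Proof.
rewrite /colsq (bigID (q_agree w)) /= [X in _ + X]big1 ?addr0; last first.
  move=> x /negPf wx; rewrite /q_lift q_agree_sym -(q_agree_congr x (q_agree_merge t w)).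
  by rewrite wx q_cabs_sqr /= expr0n addr0.
rewrite -(sum_agree w); apply: eq_bigr => x wx.
rewrite /q_lift q_agree_sym -(q_agree_congr x (q_agree_merge t w)) wx.
by rewrite q_restr_merge.
Qed.

Lemma q_tr_ptrace (rho : op) (A : opG) :
  q_optr (q_opmul rho (q_lift A)) = q_optr (q_opmul (q_ptrace (Gamma:=Gamma) rho) A).
Proof.
(* Common refinement of both sides: global indices a, b together with their restrictions s, t as
   redundant summation indices. *)
transitivity (\sum_a \sum_b \sum_s \sum_t
    (if [&& q_restr Gamma a == s, q_restr Gamma b == t & q_agree a b]
     then rho a b else 0) * A t s).
  apply: eq_bigr => a _; apply: eq_bigr => b _.
  rewrite (bigD1 (q_restr Gamma a)) //= [X in _ + X]big1 ?addr0; last first.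
    by move=> s /negPf sa; rewrite big1 // => t _; rewrite eq_sym sa mul0r.
  rewrite (bigD1 (q_restr Gamma b)) //= [X in _ + X]big1 ?addr0; last first.
    by move=> t /negPf tb; rewrite eqxx /= eq_sym tb mul0r.
  rewrite !eqxx /= /q_lift q_agree_sym.
  by case: ifP; rewrite ?mul0r ?mulr0.
rewrite /q_optr /q_opmul /q_ptrace.
under eq_bigr => a _ do rewrite exchange_big /=.
rewrite exchange_big /=; apply: eq_bigr => s _.
under eq_bigr => a _ do rewrite exchange_big /=.
rewrite exchange_big /=; apply: eq_bigr => t _.
by rewrite mulr_suml; apply: eq_bigr => a _; rewrite mulr_suml.
Qed.

Lemma q_lift_pauli (g : q_pstring 'I_n) :
  (forall k, k \notin Gamma -> g k = ord0) ->
  q_pauli R g = q_lift (q_pauli R (q_prestr Gamma g)).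
Proof.
move=> g0; apply: q_opP => x y; rewrite /q_pauli /q_lift.
rewrite (bigID (fun k => k \in Gamma)) /=.
have -> : \prod_(k | k \in Gamma) q_sigma R (g k) (x k) (y k) =
    \prod_k q_sigma R (q_prestr Gamma g k) (q_restr Gamma x k) (q_restr Gamma y k).
  rewrite (reindex_omap (fun k : q_qsub Gamma => val k) insub) /= => [|k kG]; last by rewrite insubT.
  by apply: eq_big => k; rewrite ?ffunE // valK (valP k) eqxx.
have -> : \prod_(k | k \notin Gamma) q_sigma R (g k) (x k) (y k) = (q_agree x y)%:R.
  rewrite -prod_bool_natr big_mkcond; apply: eq_bigr => k _.
  by case: ifPn => [kG|]//=; rewrite g0.
by case: ifP; rewrite ?mulr1 ?mulr0.
Qed.

Lemma q_supp_sub_lift (X : op) : q_supp_sub X Gamma ->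
  exists A : opG, X = q_lift A.
Proof.
move=> XG; pose w0 : q_basis 'I_n := [ffun=> false].
exists (fun s t => X (q_merge s w0) (q_merge t w0)).
(* Triviality is given one qubit at a time, so the qubits outside Gamma are cleared along a list, by
   induction. *)
pose clr (r : seq 'I_n) x : q_basis 'I_n := [ffun j => if j \in r then false else x j].
have clrP (r : seq 'I_n) x y : {in r, forall k, k \notin Gamma} ->
    X x y = if all (fun k => x k == y k) r then X (clr r x) (clr r y) else 0.
  elim: r => [_|k r IH rG] /=.
    by congr X; apply/ffunP => j; rewrite ffunE.
  rewrite IH => [|j jr]; last by apply: rG; rewrite inE jr orbT.
  case: (allP (s := r)) => [xy|_]; last by rewrite andbF.
  rewrite andbT (XG k (rG k (mem_head k r)) (clr r x) (clr r y)) !ffunE.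
  have clrE z : q_clrbit k (clr r z) = clr (k :: r) z.
    by apply/ffunP => j; rewrite !ffunE inE; case: eqP => //= ->; case: ifP.
  (* If [k] already occurs in [r], its bit has been cleared, and the agreement of x and y at [k]
     comes from the tail. *)
  by rewrite !clrE; have [/xy/eqP ->|//] := boolP (k \in r); rewrite !eqxx.
apply: q_opP => x y; rewrite (clrP (enum (~: Gamma))) => [|k]; last first.
  by rewrite mem_enum inE.
have clrE z : clr (enum (~: Gamma)) z = q_merge (q_restr Gamma z) w0.
  apply/ffunP => j; rewrite !ffunE mem_enum inE.
  by case: insubP => [k jG <-|/negPf ->]; rewrite ?ffunE // (valP k).
rewrite !clrE /q_lift; congr (if _ then _ else _).
apply/allP/q_agreeP => xy k; first by move=> kG; apply/eqP/xy; rewrite mem_enum inE.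
by rewrite mem_enum inE => /xy ->.
Qed.

End Localization.

(** * The bound for fixed unitaries *)

Section PointwiseBound.
Set Implicit Arguments. Unset Strict Implicit. Unset Printing Implicit Defensive.
Variables (R : realType).
Local Notation C := R[i].

Lemma q_signed_pauli_adj (Q : finType) (sgn : bool) (p : q_pstring Q) :
  let G := q_opscale ((-1) ^+ sgn) (q_pauli R p) in q_opadj G = G.
Proof.
apply: q_opP => x y; rewrite -{2}(q_pauli_adj R p) /q_opadj /q_opscale rmorphM.
by rewrite rmorphXn rmorphN1.
Qed.

Lemma q_signed_pauli_sq (Q : finType) (sgn : bool) (p : q_pstring Q) :
  let G := q_opscale ((-1) ^+ sgn) (q_pauli R p) in q_opmul G G = @q_opI R Q.
Proof.
apply: q_mx_inj; rewrite q_mxM !q_mxZ -scalemxAl -scalemxAr scalerA -signr_addb addbb.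
by rewrite expr0 scale1r -q_mxM q_pauli_sq.
Qed.

Variables (n : nat) (Gamma : {set 'I_n}).
Local Notation op := (q_op R 'I_n).
Local Notation opG := (q_op R (q_qsub Gamma)).

Definition q_anti_part (G rho : opG) : opG :=
  q_opscale 2^-1 (q_opsub rho (q_opmul (q_opmul G rho) G)).

(** The identity term of the effective state cancels the maximally mixed state; what is left is the
    Pauli sum of [q_pauli_anti_projection]. *)
Lemma q_DHS_anti_part (p : q_pstring (q_qsub Gamma)) (sgn : bool) (rho : opG) :
  let G := q_opscale ((-1) ^+ sgn) (q_pauli R p) in
  q_DHS (q_eff_state G rho) ^+ 2 = \sum_x \sum_y q_cabs (q_anti_part G rho x y) ^+ 2.
Proof.
move=> G; rewrite /q_DHS /q_frob sqr_sqrtr; last first.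
  by apply: sumr_ge0 => x _; apply: sumr_ge0 => y _; exact: sqr_ge0.
apply: eq_bigr => x _; apply: eq_bigr => y _; congr (q_cabs _ ^+ 2).
rewrite /q_anti_part [RHS]/q_opscale /q_opsub -q_pauli_anti_projection card_sig.
by rewrite /q_eff_state /q_opscale /q_opadd -mulrBr addrAC subrr add0r.
Qed.

Lemma Re_tr_anti_part (G rho M : opG) :
  q_opmul (q_opmul G M) G = q_opscale (-1) M ->
  q_optr (q_opmul rho M) = q_optr (q_opmul (q_anti_part G rho) M).
Proof.
move=> /(congr1 (fun A => q_mx A)); rewrite q_mxZ scaleN1r !q_mxM => GM.
rewrite -!q_mxtr !q_mxM q_mxZ q_mxB !q_mxM -scalemxAl mulmxBl mxtraceZ.
move: (q_mx G) (q_mx rho) (q_mx M) GM => g r m gm.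
have -> : g *m r *m g *m m = g *m (r *m g *m m) by rewrite !mulmxA.
rewrite raddfB /= (mxtrace_mulC g).
have -> : r *m g *m m *m g = - (r *m m) by rewrite -2!mulmxA (mulmxA g) gm mulmxN.
by rewrite raddfN /= opprK; field.
Qed.

Lemma q_gradient_sqr_le (g : q_pstring 'I_n) (sgn : bool) (c s : R) (O U rho : op) :
  let G := q_opscale ((-1) ^+ sgn) (q_pauli R g) in
  let G_Gamma := q_opscale ((-1) ^+ sgn) (q_pauli R (q_prestr Gamma g)) in
  let OU := q_opmul (q_opmul (q_opadj U) O) U in
  (forall k, k \notin Gamma -> g k = ord0) ->
  c ^+ 2 + s ^+ 2 = 1 -> q_unitary U -> q_supp_sub OU Gamma ->
  complex.Re (q_optr (q_opmul rho (q_grad c s G OU))) ^+ 2 <=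
  q_opnorm O ^+ 2 * (2 ^ (#|Gamma| + 2))%:R *
  q_DHS (q_eff_state G_Gamma (q_ptrace (Gamma:=Gamma) rho)) ^+ 2.
Proof.
move=> G G_Gamma OU g0 cs uU /q_supp_sub_lift[A OA].
have GE : G = q_lift G_Gamma by rewrite /G (q_lift_pauli _ g0) q_liftZ.
have gradE : q_grad c s G OU = q_lift (q_grad c s G_Gamma A).
  by rewrite GE OA q_lift_grad.
rewrite gradE q_tr_ptrace (@Re_tr_anti_part G_Gamma); last first.
  exact/q_grad_anti/q_signed_pauli_sq.
rewrite (le_trans (Re_trM_sqr_le _ _)) // q_DHS_anti_part mulrC.
rewrite ler_wpM2r //.
  by apply: sumr_ge0 => x _; apply: sumr_ge0 => y _; exact: sqr_ge0.
have card_basis : #|q_basis (q_qsub Gamma)| = (2 ^ #|Gamma|)%N.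
  by rewrite card_ffun card_bool card_sig.
apply: (@le_trans _ _ (\sum_(y : q_basis (q_qsub Gamma)) 4 * q_opnorm O ^+ 2)).
  (* Back to the full register, where [U] and the norm of [O] live; the bits [w] outside Gamma are
     an arbitrary choice. *)
  apply: ler_sum => y _; pose w : q_basis 'I_n := [ffun=> false].
  rewrite -(colsq_lift _ _ w) -gradE.
  by apply: colsq_grad_le => //; [exact: q_signed_pauli_adj|exact: q_signed_pauli_sq].
rewrite sumr_const card_basis expnD natrM -mulr_natl.
by rewrite le_eqVlt; apply/orP; left; apply/eqP; ring.
Qed.

End PointwiseBound.

(** * Bounded measurable functions and operators *)

Section BoundedMeasurable.
Set Implicit Arguments. Unset Strict Implicit. Unset Printing Implicit Defensive.
Import numFieldNormedType.Exports.
Context {R : realType} {d : measure_display} {Om : measurableType d}.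
Local Notation C := R[i].
Implicit Types (f g : Om -> R) (F H : Om -> C).

(** Unlike integrability, boundedness survives products, and on a probability space it implies
    integrability. *)
Definition bounded_mfun f :=
  measurable_fun setT f /\ exists M, forall w, `|f w| <= M.

Lemma bounded_mfun_cst (r : R) : bounded_mfun (fun=> r).
Proof. by split; [exact: measurable_cst|exists `|r|]. Qed.

Lemma bounded_mfunD f g :
  bounded_mfun f -> bounded_mfun g -> bounded_mfun (fun w => f w + g w).
Proof.
move=> [mf [M fM]] [mg [N gN]]; split; first exact: measurable_funD.
by exists (M + N) => w; rewrite (le_trans (ler_normD _ _)) // lerD.
Qed.

Lemma bounded_mfunM f g :
  bounded_mfun f -> bounded_mfun g -> bounded_mfun (fun w => f w * g w).
Proof.
move=> [mf [M fM]] [mg [N gN]]; split; first exact: measurable_funM.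
by exists (M * N) => w; rewrite normrM ler_pM.
Qed.

Lemma bounded_mfunN f : bounded_mfun f -> bounded_mfun (fun w => - f w).
Proof.
move=> [mf [M fM]]; split; first exact: measurableT_comp.
by exists M => w; rewrite normrN.
Qed.

Lemma bounded_mfunB f g :
  bounded_mfun f -> bounded_mfun g -> bounded_mfun (fun w => f w - g w).
Proof. by move=> bf bg; apply: bounded_mfunD => //; exact: bounded_mfunN. Qed.

Lemma bounded_mfunX2 f : bounded_mfun f -> bounded_mfun (fun w => f w ^+ 2).
Proof. by move=> bf; apply: bounded_mfunM. Qed.

Lemma bounded_mfun_sum (I : finType) (F : I -> Om -> R) :
  (forall i, bounded_mfun (F i)) -> bounded_mfun (fun w => \sum_i F i w).
Proof.
move=> bF; elim: (index_enum I) => [|i r IH].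
  under eq_fun do rewrite big_nil; exact: bounded_mfun_cst.
by under eq_fun do rewrite big_cons; exact: bounded_mfunD.
Qed.

Lemma bounded_mfun_integrable (P : probability Om R) f :
  bounded_mfun f -> P.-integrable setT (EFin \o f).
Proof.
move=> [mf [M fM]]; apply: measurable_bounded_integrable => //.
  exact: le_lt_trans (probability_le1 P measurableT) (ltry 1).
by exists M; split; [exact: num_real|move=> N MN w _; exact: le_trans (fM w) (ltW MN)].
Qed.

Definition bounded_mcfun F :=
  bounded_mfun (fun w => complex.Re (F w)) /\ bounded_mfun (fun w => complex.Im (F w)).

Lemma bounded_mcfun_cst (z : C) : bounded_mcfun (fun=> z).
Proof. by split; exact: bounded_mfun_cst. Qed.

Lemma bounded_mcfunD F H :
  bounded_mcfun F -> bounded_mcfun H -> bounded_mcfun (fun w => F w + H w).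
Proof.
move=> [F1 F2] [H1 H2]; split.
  rewrite [X in bounded_mfun X](_ : _ = fun w => complex.Re (F w) + complex.Re (H w)).
    exact: bounded_mfunD.
  by apply/funext => w; case: (F w) (H w) => ? ? [].
rewrite [X in bounded_mfun X](_ : _ = fun w => complex.Im (F w) + complex.Im (H w)).
  exact: bounded_mfunD.
by apply/funext => w; case: (F w) (H w) => ? ? [].
Qed.

Lemma bounded_mcfunM F H :
  bounded_mcfun F -> bounded_mcfun H -> bounded_mcfun (fun w => F w * H w).
Proof.
move=> [F1 F2] [H1 H2]; split.
  rewrite [X in bounded_mfun X](_ : _ = fun w => complex.Re (F w) * complex.Re (H w) -
      complex.Im (F w) * complex.Im (H w)).
    by apply: bounded_mfunB; exact: bounded_mfunM.
  by apply/funext => w; case: (F w) (H w) => ? ? [].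
rewrite [X in bounded_mfun X](_ : _ = fun w => complex.Re (F w) * complex.Im (H w) +
    complex.Im (F w) * complex.Re (H w)).
  by apply: bounded_mfunD; exact: bounded_mfunM.
by apply/funext => w; case: (F w) (H w) => ? ? [].
Qed.

Lemma bounded_mcfun_conj F : bounded_mcfun F -> bounded_mcfun (fun w => conjc (F w)).
Proof.
move=> [F1 F2]; split.
  rewrite [X in bounded_mfun X](_ : _ = fun w => complex.Re (F w)) //.
  by apply/funext => w; case: (F w).
rewrite [X in bounded_mfun X](_ : _ = fun w => - complex.Im (F w)).
  exact: bounded_mfunN.
by apply/funext => w; case: (F w).
Qed.

Lemma bounded_mcfun_sum (I : finType) (F : I -> Om -> C) :
  (forall i, bounded_mcfun (F i)) -> bounded_mcfun (fun w => \sum_i F i w).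
Proof.
move=> bF; elim: (index_enum I) => [|i r IH].
  under eq_fun do rewrite big_nil; exact: bounded_mcfun_cst.
by under eq_fun do rewrite big_cons; exact: bounded_mcfunD.
Qed.

Section BoundedOperators.
Variable Q : finType.
Implicit Types A B : Om -> q_op R Q.

Definition bounded_mop A := forall x y, bounded_mcfun (fun w => A w x y).

Lemma bounded_mop_cst (A : q_op R Q) : bounded_mop (fun=> A).
Proof. by move=> x y; exact: bounded_mcfun_cst. Qed.

Lemma bounded_mopM A B :
  bounded_mop A -> bounded_mop B -> bounded_mop (fun w => q_opmul (A w) (B w)).
Proof.
by move=> bA bB x y; apply: bounded_mcfun_sum => z; exact: bounded_mcfunM.
Qed.

Lemma bounded_mopD A B :
  bounded_mop A -> bounded_mop B -> bounded_mop (fun w => q_opadd (A w) (B w)).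
Proof. by move=> bA bB x y; exact: bounded_mcfunD. Qed.

Lemma bounded_mopZ (c : C) A :
  bounded_mop A -> bounded_mop (fun w => q_opscale c (A w)).
Proof.
by move=> bA x y; apply: bounded_mcfunM => //; exact: bounded_mcfun_cst.
Qed.

Lemma bounded_mopB A B :
  bounded_mop A -> bounded_mop B -> bounded_mop (fun w => q_opsub (A w) (B w)).
Proof.
move=> bA bB.
rewrite (_ : (fun w => q_opsub (A w) (B w)) =
  fun w => q_opadd (A w) (q_opscale (-1) (B w))); last first.
  apply/funext => w; apply: q_opP => x y.
  by rewrite /q_opsub /q_opadd /q_opscale mulN1r.
by apply: bounded_mopD => //; exact: bounded_mopZ.
Qed.

Lemma bounded_mop_adj A : bounded_mop A -> bounded_mop (fun w => q_opadj (A w)).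
Proof. by move=> bA x y; exact: bounded_mcfun_conj. Qed.

Lemma bounded_mop_tr A : bounded_mop A -> bounded_mcfun (fun w => q_optr (A w)).
Proof. by move=> bA; apply: bounded_mcfun_sum => x; exact: bA. Qed.

End BoundedOperators.

Lemma bounded_mop_ptrace (n : nat) (Gamma : {set 'I_n}) (A : Om -> q_op R 'I_n) :
  bounded_mop A -> bounded_mop (fun w => q_ptrace (Gamma:=Gamma) (A w)).
Proof.
move=> bA x y; apply: bounded_mcfun_sum => a; apply: bounded_mcfun_sum => b.
by case: [&& _, _ & _] => //; exact: bounded_mcfun_cst.
Qed.

Lemma q_unitary_entry_le (Q : finType) (U : q_op R Q) x y :
  q_unitary U -> q_cabs (U x y) <= 1.
Proof.
move=> uU; rewrite -(@ler_pXn2r _ 2) ?nnegrE ?q_cabs_ge0 // expr1n.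
rewrite -(colsq_unitary y uU) /colsq (bigD1 x) //= lerDl sumr_ge0 // => z _.
exact: sqr_ge0.
Qed.

(** Source of all boundedness: entries of a unitary have modulus at most 1, and the other integrands
    are polynomials in such entries and their conjugates. *)
Lemma bounded_mop_unitary (n : nat) (U : Om -> q_op R 'I_n) :
  (forall w, q_unitary (U w)) -> q_meas_op U -> bounded_mop U.
Proof.
move=> uU mU x y; have [mRe mIm] := mU x y.
have norm_le (r s : R) w : q_cabs (U w x y) ^+ 2 = r ^+ 2 + s ^+ 2 -> `|r| <= 1.
  move=> E; rewrite -(@ler_pXn2r _ 2) ?nnegrE // expr1n real_normK ?num_real //.
  have U1 : q_cabs (U w x y) ^+ 2 <= 1.
    by rewrite expr_le1 // ?q_cabs_ge0 // q_unitary_entry_le.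
  by rewrite (le_trans _ U1) // E lerDl sqr_ge0.
split; split => //; exists 1 => w.
  exact: (norm_le _ _ w (q_cabs_sqr _)).
by apply: (norm_le _ (complex.Re (U w x y)) w); rewrite q_cabs_sqr addrC.
Qed.

End BoundedMeasurable.

(** * Bounding a variance over two independent factors *)

Section ProductMeasurability.
Set Implicit Arguments. Unset Strict Implicit. Unset Printing Implicit Defensive.
Context {R : realType} {dU dV : measure_display}.
Context {OmU : measurableType dU} {OmV : measurableType dV}.

Lemma bounded_mfun_fst (f : OmU -> R) :
  bounded_mfun f -> bounded_mfun (fun ab : OmU * OmV => f ab.1).
Proof.
move=> [mf [M fM]]; split; last by exists M.
exact: (measurableT_comp mf measurable_fst).
Qed.

Lemma bounded_mfun_snd (f : OmV -> R) :
  bounded_mfun f -> bounded_mfun (fun ab : OmU * OmV => f ab.2).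
Proof.
move=> [mf [M fM]]; split; last by exists M.
exact: (measurableT_comp mf measurable_snd).
Qed.

(* The squared mean is simply dropped; an almost sure bound in [a] suffices
   because the inner integral is a measurable function of [a]. *)
Lemma q_variance2_le (PU : probability OmU R) (PV : probability OmV R)
    (X : OmU -> OmV -> R) (D : OmV -> R) (K : R) :
  bounded_mfun (fun ab : OmU * OmV => X ab.1 ab.2) -> bounded_mfun D ->
  0 <= K -> (forall b, 0 <= D b) ->
  {ae PU, forall a, forall b, X a b ^+ 2 <= K * D b} ->
  q_variance2 PU PV X <= K * Rintegral PV setT D.
Proof.
move=> bX bD K0 D0 XD; have bX2 := bounded_mfunX2 bX.
rewrite /q_variance2 (@le_trans _ _ (q_expect2 PU PV (fun a b => X a b ^+ 2))) //.
  by rewrite gerBl sqr_ge0.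
pose h a := Rintegral PV setT (fun b => X a b ^+ 2).
have h0 a : 0 <= h a by apply: Rintegral_ge0 => b _; exact: sqr_ge0.
(* Tonelli: joint measurability of the square makes the inner integral measurable. *)
have mh : measurable_fun setT h.
  apply: measurableT_comp; first exact: measurable_realfun.fine_measurable.
  apply: (@measurable_fun_fubini_tonelli_F _ _ _ _ _ PV
    (fun ab : OmU * OmV => (X ab.1 ab.2 ^+ 2)%:E)).
    by apply/measurable_EFinP; case: bX2.
  by move=> ab; rewrite lee_fin sqr_ge0.
have I0 : 0 <= K * Rintegral PV setT D.
  by rewrite mulr_ge0 // Rintegral_ge0.
(* The comparison is made in the extended reals: [Rintegral] sends an infinite integral to 0, so
   finiteness must be known before returning to real values. *)
have int_le : (\int[PU]_a (h a)%:E <= (K * Rintegral PV setT D)%:E)%E.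
  rewrite -[leRHS]mule1 -(probability_setT PU) -integral_cst //.
  apply: ae_ge0_le_integral => //.
  - by move=> a _; rewrite lee_fin.
  - exact/measurable_EFinP.
  case: XD => A [mA A0 XDA]; exists A; split => // a /= nle; apply: XDA => /= aD.
  apply: nle => _; rewrite lee_fin /h -RintegralZl //; last first.
    exact: bounded_mfun_integrable.
  apply: le_Rintegral => //.
    apply: bounded_mfun_integrable; case: bX2 => mX2 [M X2M].
    split; last by exists M => b; exact: (X2M (a, b)).
    exact: (measurableT_comp mX2 (pair1_measurable a)).
  by apply: bounded_mfun_integrable; apply: bounded_mfunM => //; exact: bounded_mfun_cst.
have int_ge0 : (0 <= \int[PU]_a (h a)%:E)%E.
  by apply: integral_ge0 => a _; rewrite lee_fin.
rewrite /q_expect2 -/h /Rintegral -lee_fin fineK // ge0_fin_numE //.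
exact: le_lt_trans int_le (ltry _).
Qed.

End ProductMeasurability.

Theorem theorem2 (R : realType) (n : nat) (rho0 O : q_op R 'I_n)
  (g : q_pstring 'I_n) (sgn : bool) (u : R) (Gamma : {set 'I_n})
  (dU dV : measure_display) (OmU : measurableType dU) (OmV : measurableType dV)
  (PU : probability OmU R) (PV : probability OmV R)
  (Uf : OmU -> q_op R 'I_n) (Vf : OmV -> q_op R 'I_n) (theta : R) :
  q_density rho0 ->
  q_hermitian O ->
  0 < u ->
  (forall a, q_unitary (Uf a)) -> q_meas_op Uf ->
  (forall b, q_unitary (Vf b)) -> q_meas_op Vf ->
  q_locally_scrambling PV Vf ->
  (forall k, k \notin Gamma -> g k = ord0) ->
  {ae PU, forall a, q_supp_sub (q_opmul (q_opmul (q_opadj (Uf a)) O) (Uf a)) Gamma} ->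
  let G := q_opscale ((-1) ^+ sgn) (q_pauli R g) in
  let G_Gamma := q_opscale ((-1) ^+ sgn) (q_pauli R (q_prestr Gamma g)) in
  q_variance2 PU PV (fun a b => derive1 (q_cost rho0 O G u (Uf a) (Vf b)) theta)
  <= u ^+ 2 * q_opnorm O ^+ 2 * (2 ^ (#|Gamma| + 2))%:R *
     Rintegral PV setT (fun b =>
       q_DHS (q_eff_state G_Gamma
              (q_ptrace (Gamma:=Gamma) (q_opmul (q_opmul (Vf b) rho0) (q_opadj (Vf b))))) ^+ 2).
Proof.
move=> _ _ _ uU mU uV mV _ g0 OUG; cbv zeta.
set G := q_opscale _ (q_pauli R g); set G_Gamma := q_opscale _ _.
have GA : q_opadj G = G by exact: q_signed_pauli_adj.
have GG : q_opmul G G = @q_opI R 'I_n by exact: q_signed_pauli_sq.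
have bU := bounded_mop_unitary uU mU; have bV := bounded_mop_unitary uV mV.
pose rho b := q_opmul (q_opmul (Vf b) rho0) (q_opadj (Vf b)).
pose M a := q_grad (cos (u * theta)) (sin (u * theta)) G
  (q_opmul (q_opmul (q_opadj (Uf a)) O) (Uf a)).
have XE a b : derive1 (q_cost rho0 O G u (Uf a) (Vf b)) theta =
    u * complex.Re (q_optr (q_opmul (rho b) (M a))) by exact: q_cost_gradient.
have brho : bounded_mop rho.
  apply: bounded_mopM; last exact: bounded_mop_adj.
  by apply: bounded_mopM => //; exact: bounded_mop_cst.
have bM : bounded_mop M.
  have bOU : bounded_mop (fun a => q_opmul (q_opmul (q_opadj (Uf a)) O) (Uf a)).
    apply: bounded_mopM => //; apply: bounded_mopM; first exact: bounded_mop_adj.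
    exact: bounded_mop_cst.
  have bG := @bounded_mop_cst R dU OmU 'I_n G.
  apply: bounded_mopD; apply: bounded_mopZ; apply: bounded_mopB => //.
  - by apply: bounded_mopM => //; exact: bounded_mopM.
  - exact: bounded_mopM.
  - exact: bounded_mopM.
have -> : u ^+ 2 * q_opnorm O ^+ 2 * (2 ^ (#|Gamma| + 2))%:R =
    u ^+ 2 * (q_opnorm O ^+ 2 * (2 ^ (#|Gamma| + 2))%:R) by rewrite mulrA.
apply: q_variance2_le.
- rewrite (_ : (fun ab => _) = fun ab : OmU * OmV =>
      u * complex.Re (q_optr (q_opmul (rho ab.2) (M ab.1)))); last first.
    by apply/funext => ab; exact: XE.
  apply: bounded_mfunM; first exact: bounded_mfun_cst.
  suff [] : bounded_mcfun (fun ab : OmU * OmV =>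
    q_optr (q_opmul (rho ab.2) (M ab.1))) by [].
  apply: bounded_mop_tr; apply: bounded_mopM => x y.
    have [bRe bIm] := brho x y.
    by split; [exact: (bounded_mfun_snd bRe)|exact: (bounded_mfun_snd bIm)].
  have [bRe bIm] := bM x y.
  by split; [exact: (bounded_mfun_fst bRe)|exact: (bounded_mfun_fst bIm)].
- have bpt := bounded_mop_ptrace (Gamma:=Gamma) brho.
  have bG := @bounded_mop_cst R dV OmV (q_qsub Gamma) G_Gamma.
  have banti : bounded_mop (fun b =>
      q_anti_part G_Gamma (q_ptrace (Gamma:=Gamma) (rho b))).
    apply: bounded_mopZ; apply: bounded_mopB => //.
    by apply: bounded_mopM => //; exact: bounded_mopM.
  (* Rewritten without square roots, the squared distance is a polynomial in bounded measurable
     entries. *)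
  rewrite [X in bounded_mfun X](_ : _ = fun b => \sum_x \sum_y
      (complex.Re (q_anti_part G_Gamma (q_ptrace (Gamma:=Gamma) (rho b)) x y) ^+ 2 +
       complex.Im (q_anti_part G_Gamma (q_ptrace (Gamma:=Gamma) (rho b)) x y) ^+ 2)).
    apply: bounded_mfun_sum => x; apply: bounded_mfun_sum => y.
    by have [bRe bIm] := banti x y; apply: bounded_mfunD; exact: bounded_mfunX2.
  apply/funext => b; rewrite q_DHS_anti_part.
  by apply: eq_bigr => x _; apply: eq_bigr => y _; rewrite q_cabs_sqr.
- by rewrite mulr_ge0 ?sqr_ge0 // mulr_ge0 ?sqr_ge0 ?ler0n.
- by move=> b; exact: sqr_ge0.
(* The null set outside which U^* O U is supported on Gamma also serves as the exceptional set of
   the pointwise bound. *)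
case: OUG => A [mA A0 sub]; exists A; split => // a /= nle; apply: sub => /= aG.
apply: nle => b; rewrite XE exprMn -mulrA ler_wpM2l ?sqr_ge0 //.
by apply: q_gradient_sqr_le => //; exact: cos2Dsin2.
Qed.
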